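(* Let $G$ be a simple graph with $\chi(G)\le4$ and $\chi'(G)=\Delta(G)$. Then $\chi''(G)\le\Delta(G)+2$.
   Context: $\chi(G)$ is the chromatic number, $\chi'(G)$ the edge-chromatic number (minimum number of colors in a proper edge-coloring), and $\Delta(G)$ the maximum degree. A total coloring of $G$ colors $V(G)\cup E(G)$ so that any two adjacent vertices, any two edges sharing an endpoint, and any vertex and an edge incident to it receive distinct colors; $\chi''(G)$ is the minimum number of colors in a total coloring. *)

(* Defs.v *)
From mathcomp Require Import all_boot.

Set Implicit Arguments.
Unset Strict Implicit.
Unset Printing Implicit Defensive.

Record sgraph := SGraph {
  vertex :> finType;
  adj : rel vertex;
  adj_sym : symmetric adj;
  adj_irr : irreflexive adj }.

Definition edges (G : sgraph) : {set {set G}} :=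
  [set [set x; y] | x in G, y in G & adj x y].

Definition edge (G : sgraph) : finType := {e : {set G} | e \in edges G}.

Definition degree (G : sgraph) (x : G) : nat := #|[set y | adj x y]|.

Definition max_degree (G : sgraph) : nat := \max_(x : G) degree x.

(* The vertex, edge and total colorings of a graph are all colorings of a     *)
(* finite set of objects in which objects in conflict get distinct colors;    *)
(* they differ only in the objects and in the conflict relation.              *)
Definition proper_coloring (T : finType) (r : rel T) (k : nat)
    (c : {ffun T -> 'I_k}) : bool :=
  [forall x, forall y, r x y ==> (c x != c y)].

Definition colorable (T : finType) (r : rel T) (k : nat) : bool :=
  [exists c : {ffun T -> 'I_k}, proper_coloring r c].

Lemma colorable_ex (T : finType) (r : rel T) :
  irreflexive r -> exists k, colorable r k.
Proof.
move=> irr; exists #|T|; apply/existsP; exists [ffun x => enum_rank x].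
apply/forallP=> x; apply/forallP=> y; apply/implyP=> rxy.
rewrite !ffunE (inj_eq enum_rank_inj).
by apply: contraTneq rxy => ->; rewrite irr.
Qed.

Definition min_colors (T : finType) (r : rel T) (irr : irreflexive r) : nat :=
  ex_minn (colorable_ex irr).

Definition edge_adj (G : sgraph) : rel (edge G) :=
  fun e f => (e != f) && (val e :&: val f != set0).

(* The objects of a total coloring are V(G) + E(G), as a disjoint sum. *)
Definition total_adj (G : sgraph) : rel (G + edge G)%type :=
  fun u v => match u, v with
  | inl x, inl y => adj x y
  | inl x, inr e => x \in val e
  | inr e, inl x => x \in val e
  | inr e, inr f => edge_adj e f
  end.

Lemma edge_adj_irr (G : sgraph) : irreflexive (@edge_adj G).
Proof. by move=> e; rewrite /edge_adj eqxx. Qed.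

Lemma total_adj_irr (G : sgraph) : irreflexive (@total_adj G).
Proof. by case=> [x|e] /=; [apply: adj_irr | apply: edge_adj_irr]. Qed.

Definition chromatic_number (G : sgraph) : nat := min_colors (@adj_irr G).

Definition edge_chromatic_number (G : sgraph) : nat :=
  min_colors (@edge_adj_irr G).

Definition total_chromatic_number (G : sgraph) : nat :=
  min_colors (@total_adj_irr G).

(* Main.v *)
Require Import Defs.
From mathcomp Require Import all_boot zify.

Set Implicit Arguments.
Unset Strict Implicit.
Unset Printing Implicit Defensive.

(** If [Delta <= 1], two colors for the vertices and one for the edges suffice.
    Otherwise take two color classes [M1], [M2] of an edge-coloring with [Delta] colors, and
    recolor their edges with the four colors of a vertex coloring of [G]: the
    edge [xy] avoids the colors of [x] and [y], which leaves it a list of two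
    colors, and the other [Delta - 2] classes keep their own colors.
    Choosing from the lists is possible because [M1 :|: M2] consists of paths
    and even cycles. Following Galvin, the conflicts between [M1] and [M2] are
    oriented with out-degree at most one, by means of a 2-coloring of the
    vertices of [M1 :|: M2], and every set of edges of [M1 :|: M2] has a kernel
    since the conflict graph is bipartite. *)

(** Colors become plain numbers, so palettes of different sizes can be shifted and compared by
    arithmetic. *)
Lemma min_colors_leP (T : finType) (r : rel T) (irr : irreflexive r) (k : nat) :
  min_colors irr <= k <->
  exists f : T -> nat,
    (forall x, f x < k) /\ (forall x y, r x y -> f x <> f y).
Proof.
split=> [|[f [fk fr]]].
  rewrite /min_colors; case: ex_minnP => m /existsP[c /forallP cP] _ mk.
  exists (fun x => nat_of_ord (c x)); split=> [x|x y rxy /val_inj cxy].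
    exact: leq_trans (ltn_ord _) mk.
  by move/forallP/(_ y): (cP x); rewrite rxy cxy eqxx.
rewrite /min_colors; case: ex_minnP => m _; apply.
apply/existsP; exists [ffun x => Ordinal (fk x)].
apply/forallP=> x; apply/forallP=> y; apply/implyP=> rxy.
by rewrite !ffunE; apply/eqP=> /(congr1 val); exact: fr rxy.
Qed.

(** * Bicoloring the union of two matchings *)

(** The orbits of [s1 \o s2] come in pairs: [s1 x] lies outside the orbit of [x], while [s2 x]
    shares the orbit of [s1 x]. So both involutions swap the two orbits of a pair, and [o] selects
    one of them. *)
Lemma involutions_bicoloring (T : finType) (s1 s2 : T -> T) :
    involutive s1 -> involutive s2 ->
    (forall x, s1 x != x) -> (forall x, s2 x != x) ->
  exists o : T -> bool,
    (forall x, o (s1 x) = ~~ o x) /\ (forall x, o (s2 x) = ~~ o x).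
Proof.
move=> s1K s2K s1x s2x; pose phi x := s1 (s2 x).
have phi_inj : injective phi by move=> x y /(inv_inj s1K)/(inv_inj s2K).
(* [s1] conjugates [phi] to its inverse, so a midpoint of a [phi]-path from
   [x] to [s1 x] would be a fixed point of [s1] or of [s2]. *)
have iter_phi k x : iter k phi x != s1 x.
  elim/ltn_ind: k x => -[_ x|[_ x|k IH x]]; first by rewrite eq_sym s1x.
    by rewrite /= (inj_eq (inv_inj s1K)).
  apply: contraNneq (IH k (leqnSn k.+1) (phi x)); rewrite iterS => /(inv_inj s1K).
  move/(congr1 s2); rewrite s2K => /(congr1 s1).
  by rewrite -iterSr /= /phi s1K => <-.
have sym := fconnect_sym phi_inj.
have root_neq x : froot phi x != froot phi (s1 x).
  rewrite (root_connect sym); apply/negP=> /iter_findex/eqP.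
  exact/negP.
have root_s2 x : froot phi (s2 x) = froot phi (s1 x).
  apply/eqP; rewrite (root_connect sym).
  have -> : s1 x = phi (s2 x) by rewrite /phi s2K.
  exact: fconnect1.
have root_s12 x : froot phi (s1 (s2 x)) = froot phi x.
  by apply/eqP; rewrite (root_connect sym) sym; exact: fconnect1.
(* Of the two paired orbits, the one whose root is enumerated first gets [true]. *)
exists (fun x => enum_rank (froot phi x) < enum_rank (froot phi (s1 x))).
have key x : (enum_rank (froot phi (s1 x)) < enum_rank (froot phi x)) =
  ~~ (enum_rank (froot phi x) < enum_rank (froot phi (s1 x))).
  by case: ltngtP (root_neq x) => // /val_inj/enum_rank_inj->; rewrite eqxx.
by split=> x; rewrite ?s1K ?root_s2 ?root_s12 key.
Qed.

Section TwoMatchings.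
Variable T : finType.

Definition matching (m : rel T) : Prop :=
  [/\ symmetric m, irreflexive m & forall x y z, m x y -> m x z -> y = z].

(* Two copies of [T] are used, so that an unmatched vertex can be paired with
   its twin. *)
Definition mate (m : rel T) (u : T * bool) : T * bool :=
  if [pick y | m u.1 y] is Some y then (y, u.2) else (u.1, ~~ u.2).

Lemma mateE (m : rel T) (x y : T) (b : bool) :
  matching m -> m x y -> mate m (x, b) = (y, b).
Proof.
move=> [_ _ mf] mxy; rewrite /mate; case: pickP => /= [z mxz|/(_ y)].
  by rewrite (mf _ _ _ mxz mxy).
by rewrite mxy.
Qed.

Lemma mate_involutive (m : rel T) : matching m -> involutive (mate m).
Proof.
move=> mm [x b]; have [ms _ _] := mm.
rewrite {2}/mate; case: pickP => /= [y mxy|mx].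
  by rewrite (mateE _ mm (y := x)) // ms.
by rewrite /mate; case: pickP => /= [y|]; rewrite ?mx // negbK.
Qed.

Lemma mate_neq (m : rel T) (u : T * bool) : matching m -> mate m u != u.
Proof.
move=> [_ mi _]; case: u => x b; rewrite /mate; case: pickP => /= [y mxy|_].
  by apply: contraTneq mxy => -[->]; rewrite mi.
by rewrite xpair_eqE eqxx; case: b.
Qed.

(** Matched vertices have their mates in the same copy of [T], so a bicoloring of the doubled set
    can be restricted to one copy. *)
Lemma matchings_bicoloring (m1 m2 : rel T) : matching m1 -> matching m2 ->
  exists o : T -> bool, forall x y, m1 x y || m2 x y -> o y = ~~ o x.
Proof.
move=> mm1 mm2.
have [o [o1 o2]] := involutions_bicoloring (mate_involutive mm1)
  (mate_involutive mm2) (fun u => mate_neq u mm1) (fun u => mate_neq u mm2).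
exists (fun x => o (x, true)) => x y /orP[] mxy.
  by rewrite -(mateE true mm1 mxy) o1.
by rewrite -(mateE true mm2 mxy) o2.
Qed.

End TwoMatchings.

(** * Kernels and list coloring *)

Section Galvin.
Variables (T : finType) (d : rel T) (side : pred T).
Hypothesis d_side : forall x y, d x y -> side x != side y.

Definition kernel (A K : {set T}) : Prop :=
  [/\ K \subset A, {in K &, forall x y, ~~ d x y} &
      forall x, x \in A :\: K -> exists2 y, y \in K & d x y].

(** A sink of [A] joins the kernel and is deleted with its in-neighbors. If there is no sink, each
    vertex of [A] has an out-neighbor in [A], necessarily on the other side, so one side is a
    kernel. *)
Lemma bipartite_kernel (A : {set T}) : exists K, kernel A K.
Proof.
have [n] := ubnP #|A|; elim: n A => // n IH A /ltnSE leAn.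
have [/existsP[v /andP[vA /forall_inP vsink]]|nosink] :=
    boolP [exists v, (v \in A) && [forall y in A, ~~ d v y]]; last first.
  exists (A :&: [set x | side x]); split; first exact: subsetIl.
    move=> x y; rewrite !inE => /andP[_ sx] /andP[_ sy].
    by apply/negP=> /d_side; rewrite sx sy.
  move=> x; rewrite !inE => /andP[+ xA]; rewrite xA /= => nsx.
  move: nosink; rewrite negb_exists => /forallP/(_ x).
  rewrite xA negb_forall_in /= => /exists_inP[y yA]; rewrite negbK => dxy.
  exists y => //; rewrite !inE yA /=.
  by move: (d_side dxy) nsx; case: (side x); case: (side y).
pose A' := A :\ v :\: [set x | d x v].
have [|K [KA' Kind Kdom]] := IH A'.
  apply: leq_trans leAn; rewrite [X in _ < X](cardsD1 v) vA ltnS.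
  exact/subset_leq_card/subsetDl.
have KA : {subset K <= A'} by exact/subsetP.
have dvv : ~~ d v v by exact: vsink.
exists (v |: K); split.
- rewrite subUset sub1set vA /=; apply/subsetP=> x /KA.
  by rewrite !inE => /and3P[].
- move=> x y /setU1P[->|xK] /setU1P[->|yK] //; last exact: Kind.
    by apply: vsink; move/KA: yK; rewrite !inE => /and3P[].
  by move/KA: xK; rewrite !inE => /and3P[].
move=> x; rewrite !inE negb_or => /andP[/andP[xv xK] xA].
have [dxv|ndxv] := boolP (d x v); first by exists v; rewrite ?setU11.
have [|y yK dxy] := Kdom x; first by rewrite !inE xK ndxv xv xA.
by exists y => //; rewrite setU1r.
Qed.

(** Color [a] goes to a kernel of the vertices that have [a] in their lists. Any other such vertex
    loses the color [a] but also an out-neighbor, so the degree condition survives. *)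
Lemma bipartite_list_coloring (C : finType) (c0 : C) (S : {set T})
    (L : T -> {set C}) :
    {in S, forall x, #|[set y in S | d x y]| < #|L x|} ->
  exists c : T -> C,
    {in S, forall x, c x \in L x} /\ {in S &, forall x y, d x y -> c x <> c y}.
Proof.
have [n] := ubnP #|S|; elim: n S L => // n IH S L /ltnSE leSn degL.
have [->|[x xS]] := set_0Vmem S.
  by exists (fun=> c0); split=> x; rewrite inE.
have /card_gt0P[a aLx] : 0 < #|L x| by apply: leq_trans (degL x xS).
have [K [KA Kind Kdom]] := bipartite_kernel [set y in S | a \in L y].
have KS y : y \in K -> y \in S /\ a \in L y.
  by move/(subsetP KA); rewrite inE => /andP[].
(* A nonempty kernel makes [S :\: K] smaller than [S]. *)
have [z zK] : exists z, z \in K.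
  have [xK|xNK] := boolP (x \in K); first by exists x.
  by have [|y yK _] := Kdom x; [rewrite !inE xNK xS | exists y].
have [||c [cL cd]] := IH (S :\: K) (fun y => L y :\ a).
- apply: leq_trans leSn; apply: proper_card; apply/properP; split.
    exact: subsetDl.
  by exists z; [case/KS: zK | rewrite inE zK].
- move=> y; rewrite inE => /andP[yNK yS]; move: (degL y yS).
  rewrite (cardsD1 a (L y)); have [ya|_] := boolP (a \in L y); last first.
    rewrite add0n; apply: leq_ltn_trans; apply: subset_leq_card.
    by apply/subsetP=> w; rewrite !inE => /andP[/andP[_ ->] ->].
  rewrite add1n ltnS; apply: leq_trans; apply: proper_card.
  have [|w wK dyw] := Kdom y; first by rewrite !inE yNK yS ya.
  apply/properP; split.
    by apply/subsetP=> u; rewrite !inE => /andP[/andP[_ ->] ->].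
  by exists w; rewrite !inE ?wK // dyw andbT; case/KS: wK.
have cLa y : y \in S -> y \notin K -> c y \in L y /\ c y != a.
  by move=> yS yK; have := cL y; rewrite !inE yS yK => /(_ isT)/andP[].
exists (fun y => if y \in K then a else c y); split=> [y yS|y w yS wS dyw].
  by case: ifPn => [/KS[]|/(cLa y yS)[]].
case: ifPn => yK; case: ifPn => wK.
- by have := Kind y w yK wK; rewrite dyw.
- by move=> e; have [_] := cLa w wS wK; rewrite e eqxx.
- by move=> e; have [_] := cLa y yS yK; rewrite e eqxx.
by apply: cd => //; rewrite inE ?yK ?wK.
Qed.

End Galvin.

(** * Edges, ends and degrees; the case of maximum degree at most one *)

Section TotalColoring.
Variable G : sgraph.

Lemma adj_neq (x y : G) : adj x y -> x != y.
Proof. by apply: contraTneq => ->; rewrite adj_irr. Qed.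

Lemma edge_ends (e : edge G) : exists x y : G, adj x y /\ val e = [set x; y].
Proof.
by case: e => e /= /imset2P[x y _]; rewrite inE => /andP[_ xy] ->; exists x, y.
Qed.

Lemma edge_other_end (e : edge G) (x : G) :
  x \in val e -> exists2 y, adj x y & val e = [set x; y].
Proof.
have [u [v [uv ->]]] := edge_ends e; rewrite !inE => /orP[]/eqP->.
  by exists v.
by exists u; rewrite 1?adj_sym // setUC.
Qed.

Lemma degree_le_max (x : G) : degree x <= max_degree G.
Proof. exact: (leq_bigmax_cond x). Qed.

Lemma adj_max_degree (x y : G) : adj x y -> 0 < max_degree G.
Proof.
move=> xy; apply: leq_trans (degree_le_max x).
by apply/card_gt0P; exists y; rewrite inE.
Qed.

Lemma total_chromatic_max_degree_le1 :
  max_degree G <= 1 -> total_chromatic_number G <= max_degree G + 2.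
Proof.
move=> D1.
have nbr (x y z : G) : adj x y -> adj x z -> y = z.
  move=> xy xz; have /card_le1_eqP h := leq_trans (degree_le_max x) D1.
  by apply: h; rewrite inE.
pose f (u : G + edge G) := match u with
  | inl x => nat_of_bool [exists y, adj x y && (enum_rank x < enum_rank y)]
  | inr _ => 2
  end.
apply/min_colors_leP; exists f; split.
  move=> [x|e] /=; first by case: [exists _, _]; lia.
  (* An edge forces the maximum degree to be positive, so color 2 is in range. *)
  by have [x [y [/adj_max_degree + _]]] := edge_ends e; lia.
have end_edge (x : G) : f (inl x) <> 2 by move=> /=; case: [exists _, _].
move=> [x|e] [y|e'] //=; last 1 first.
- case/andP=> ne /set0Pn[x]; rewrite inE => /andP[xe xe'].
  have [y xy ey] := edge_other_end xe; have [z xz ez] := edge_other_end xe'.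
  by case/eqP: ne; apply: val_inj; rewrite ey ez (nbr _ _ _ xy xz).
- move=> xy; have val_f (u v : G) : adj u v ->
      [exists y, adj u y && (enum_rank u < enum_rank y)]
      = (enum_rank u < enum_rank v).
    move=> uv; apply/existsP/idP=> [[w /andP[uw]]|ltuv].
      by rewrite (nbr _ _ _ uw uv).
    by exists v; rewrite uv.
  rewrite (val_f x y) // (val_f y x) 1?adj_sym //.
  case: ltngtP => // /val_inj/enum_rank_inj exy.
  by have := adj_neq xy; rewrite exy eqxx.
- by move=> _; exact: end_edge.
by move=> _ /esym; exact: end_edge.
Qed.

(** * Recoloring two color classes *)

Definition color_class (ec : edge G -> nat) (i : nat) : rel G :=
  fun x y => adj x y && [exists e, (ec e == i) && (val e == [set x; y])].

Lemma color_class_matching (ec : edge G -> nat) (i : nat) :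
  (forall e f, edge_adj e f -> ec e <> ec f) -> matching (color_class ec i).
Proof.
move=> ecP; split.
- by move=> x y; rewrite /color_class adj_sym setUC.
- by move=> x; rewrite /color_class adj_irr.
move=> x y z /andP[xy /existsP[e /andP[/eqP ei /eqP eE]]].
move=> /andP[xz /existsP[f /andP[/eqP fi /eqP fE]]].
have ef : e = f.
  apply/eqP; apply/negPn/negP=> ne; apply: (ecP e f); last by rewrite ei.
  rewrite /edge_adj ne; apply/set0Pn; exists x.
  by rewrite eE fE !inE eqxx.
have : y \in [set x; z] by rewrite -fE -ef eE !inE eqxx orbT.
by rewrite !inE eq_sym (negbTE (adj_neq xy)) => /eqP.
Qed.

(** As [o] differs at the two ends of an edge, only one end carries outgoing conflicts, and at most
    one of them. A list of two colors thus exceeds the out-degree. *)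
Lemma two_classes_recoloring (vc : G -> 'I_4) (ec : edge G -> nat) :
    (forall x y, adj x y -> vc x != vc y) ->
    (forall e f, edge_adj e f -> ec e <> ec f) ->
  exists g : edge G -> 'I_4,
    (forall e x, ec e < 2 -> x \in val e -> g e != vc x) /\
    (forall e f, ec e < 2 -> ec f < 2 -> edge_adj e f -> g e <> g f).
Proof.
move=> vcP ecP.
have [o oP] := matchings_bicoloring (color_class_matching 0 ecP)
                 (color_class_matching 1 ecP).
have o_end (e : edge G) (x y : G) : ec e < 2 -> adj x y ->
    val e = [set x; y] -> o y = ~~ o x.
  move=> e2 xy ee; apply: oP; rewrite /color_class xy /=.
  by apply/orP; case E: (ec e) e2 => [|[|]] // _; [left|right];
    apply/existsP; exists e; rewrite E ee !eqxx.
(* A conflict at [x] points away from the edge of class 0 iff [o x]. *)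
pose d : rel (edge G) := fun e f =>
  [&& ec e < 2, ec f < 2, e != f &
    [exists x, [&& x \in val e, x \in val f & o x == (ec e == 0)]]].
have d_side e f : d e f -> (ec e == 0) != (ec f == 0).
  case/and4P=> e2 f2 ne /existsP[x /and3P[xe xf _]].
  have : ec e <> ec f.
    by apply: ecP; rewrite /edge_adj ne; apply/set0Pn; exists x; rewrite inE xe.
  lia.
pose S := [set e : edge G | ec e < 2].
pose L (e : edge G) : {set 'I_4} := ~: (vc @: val e).
have [|g [gL gd]] := bipartite_list_coloring d_side (ord0 : 'I_4)
  (S := S) (L := L).
  move=> e; rewrite inE => e2.
  have -> : #|L e| = 2.
    have [x [y [xy ee]]] := edge_ends e.
    by rewrite cardsCs setCK card_ord ee imsetU !imset_set1 cards2 (vcP _ _ xy).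
  rewrite ltnS; apply/card_le1_eqP=> f f'; rewrite !inE.
  case/andP=> f2 def /andP[f2' def'].
  have [_ _ _ /existsP[x /and3P[xe xf /eqP ox]]] := and4P def.
  have [_ _ _ /existsP[x' /and3P[xe' xf' /eqP ox']]] := and4P def'.
  have xx' : x' = x.
    have [y xy ee] := edge_other_end xe.
    move: xe'; rewrite ee !inE => /orP[/eqP//|/eqP E].
    by move: (o_end _ _ _ e2 xy ee); rewrite -E ox ox'; case: (ec e == 0).
  (* Both out-neighbors contain [x] and belong to the class opposite to that of [e], which is a
     matching. *)
  apply/eqP; apply/negPn/negP=> ne; apply: (ecP f' f).
    by rewrite /edge_adj ne; apply/set0Pn; exists x; rewrite inE xf -xx' xf'.
  by have := d_side _ _ def; have := d_side _ _ def'; lia.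
exists g; split=> [e x e2 xe|e f e2 f2 ef].
  have := gL e; rewrite !inE => /(_ e2); apply: contraNneq => ->.
  exact: imset_f.
(* The list coloring separates edges only along [d], so each conflict must be oriented one way or
   the other. *)
have dor : d e f \/ d f e.
  have necf := ecP _ _ ef.
  case/andP: ef => ne /set0Pn[x]; rewrite inE => /andP[xe xf].
  have [ox|ox] : o x = (ec e == 0) \/ o x = (ec f == 0).
    by move: necf e2 f2; case: (ec e) (ec f) => [|[|n]] [|[|k]] //;
      case: (o x); auto.
    by left; rewrite /d e2 f2 ne; apply/existsP; exists x; rewrite xe xf ox eqxx.
  by right; rewrite /d e2 f2 eq_sym ne; apply/existsP; exists x; rewrite xe xf ox eqxx.
case: dor => dd; first by apply: gd => //; rewrite inE.
by apply/nesym; apply: gd => //; rewrite inE.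
Qed.

End TotalColoring.

(** * Assembling the total coloring *)

Theorem theorem4p3 (G : sgraph) :
  chromatic_number G <= 4 ->
  edge_chromatic_number G = max_degree G ->
  total_chromatic_number G <= max_degree G + 2.
Proof.
move=> /min_colors_leP[vc [vc4 vcP]] chi'.
have [D1|D2] := leqP (max_degree G) 1; first exact: total_chromatic_max_degree_le1.
have /min_colors_leP[ec [ecD ecP]] : edge_chromatic_number G <= max_degree G.
  by rewrite chi'.
have [|g [gv ge]] := two_classes_recoloring (vc := fun x => Ordinal (vc4 x)) _ ecP.
  by move=> x y /vcP/eqP.
(* Vertices and recolored edges share the colors 0 to 3, which are in range as the maximum degree is
   at least 2. The shift by 2 sends the remaining classes to the colors from 4 on. *)
pose f (u : G + edge G) := match u with
  | inl x => vc x
  | inr e => if ec e < 2 then nat_of_ord (g e) else ec e + 2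
  end.
have f_inc (x : G) (e : edge G) : x \in val e -> f (inl x) <> f (inr e).
  move=> xe /=; case: ifPn => [e2|]; last by have := vc4 x; lia.
  by have /eqP := gv e x e2 xe => + E; apply; apply: val_inj.
apply/min_colors_leP; exists f; split.
  move=> [x|e] /=; first by have := vc4 x; lia.
  by case: ifP => _; have := ltn_ord (g e); have := ecD e; lia.
move=> [x|e] [y|e']; rewrite [total_adj _ _]/=.
- exact: vcP.
- exact: f_inc.
- by move=> ye /esym; exact: f_inc.
move=> ee /=; have := ecP _ _ ee.
case: ifPn => e2; case: ifPn => e2'; have := ltn_ord (g e);
  have := ltn_ord (g e'); try lia.
by move=> _ _ _ /val_inj; exact: ge.
Qed.
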